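(* For every integer $j\ge 0$, $$\sum_{n=1}^{\infty}\frac{4^n}{n^2\binom{2n}{n}}\,t_n^{\star}(\{2\}_j)=8\sum_{k=0}^{2j}(-1)^k\,\beta(k+1)\,\beta(2j-k+1).$$
   Context: For integers $n\ge 1$ and $j\ge 0$, the multiple $t$-harmonic star sum of depth $j$ and weight $2j$ is $$t_n^{\star}(\{2\}_j)=\sum_{n\ge k_1\ge\dots\ge k_j\ge 1}\prod_{i=1}^j\frac{1}{(2k_i-1)^2},$$ equivalently $t_n^{\star}(\emptyset)=1$ and $t_n^{\star}(\{2\}_j)=\sum_{k=1}^n \frac{t_k^{\star}(\{2\}_{j-1})}{(2k-1)^2}$ for $j\ge1$. The Dirichlet beta function is $\beta(m)=\sum_{k=1}^\infty \frac{(-1)^{k-1}}{(2k-1)^m}$ for integers $m\ge1$ (so $\beta(1)=\pi/4$). *)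

(* Defs.v *)
From Stdlib Require Import Reals.
From Coquelicot Require Import Coquelicot.
Open Scope R_scope.

Fixpoint sumto (f : nat -> R) (n : nat) : R :=
  match n with
  | O => 0
  | S m => sumto f m + f (S m)
  end.

Fixpoint tstar2 (j : nat) (n : nat) : R :=
  match j with
  | O => 1
  | S j' => sumto (fun k => tstar2 j' k / (2 * INR k - 1) ^ 2) n
  end.

(* Dirichlet beta: beta m = sum_{k>=1} (-1)^(k-1)/(2k-1)^m, reindexed from k=0. *)
Definition dbeta (m : nat) : R :=
  Series (fun k : nat => (-1) ^ k / (2 * INR k + 1) ^ m).

(* Main.v *)
(** Let c_n = C(2n,n)/4^n, u(n,k) = C(2n,n-k)/4^n and a(n,k) = u(n,k)(n+k)/n^2.
    The generating function of t*_n({2}_j) in x^(2j) is the product over k <= n of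
    1/(1 - x^2/(2k-1)^2); its partial fractions give
      t*_n({2}_j) / (n^2 c_n) = 4 sum_{k<=n} e_k a(n,k),  e_k = (-1)^(k-1)/(2k-1)^(2j+1).
    The columns S_k = sum_n a(n,k) satisfy S_k + S_{k+1} = 2/k, because
    sum_n k u(n,k)/n = 1. On the other side, the convolution of beta values
    truncated at N collapses, by the geometric sum of ratio -(2l-1)/(2m-1), to
      sum_{m<=N} e_m sum_{l<=N} (-1)^(l-1)/(m+l-1),
    whose inner sum is (S_m - (-1)^N S_{m+N})/2. Both 8 times this and the N-th partial
    sum of the series are thus 4 sum_{k<=N} e_k S_k up to errors which are alternating
    sums of decreasing terms, hence bounded by their first term, which tends to 0. *)

Require Import Defs.
From Stdlib Require Import Reals.
From Coquelicot Require Import Coquelicot.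
From Stdlib Require Import Lra Lia.
Open Scope R_scope.

(** * Finite sums over 1..n, and bounds for alternating sums *)

Lemma sumto_ext (f g : nat -> R) (n : nat) :
  (forall k, (1 <= k <= n)%nat -> f k = g k) -> sumto f n = sumto g n.
Proof.
  induction n as [|n IH]; intros H; simpl; [easy|].
  rewrite IH by (intros; apply H; lia). rewrite H by lia. easy.
Qed.

Lemma sumto_plus (f g : nat -> R) (n : nat) :
  sumto (fun k => f k + g k) n = sumto f n + sumto g n.
Proof. induction n as [|n IH]; simpl; [|rewrite IH]; ring. Qed.

Lemma sumto_scal (a : R) (f : nat -> R) (n : nat) :
  sumto (fun k => a * f k) n = a * sumto f n.
Proof. induction n as [|n IH]; simpl; [|rewrite IH]; ring. Qed.

Lemma sumto_minus (f g : nat -> R) (n : nat) :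
  sumto (fun k => f k - g k) n = sumto f n - sumto g n.
Proof. induction n as [|n IH]; simpl; [|rewrite IH]; ring. Qed.

Lemma sumto_zero (n : nat) : sumto (fun _ => 0) n = 0.
Proof. induction n as [|n IH]; simpl; [|rewrite IH]; ring. Qed.

Lemma sumto_swap (f : nat -> nat -> R) (n m : nat) :
  sumto (fun i => sumto (f i) m) n = sumto (fun j => sumto (fun i => f i j) n) m.
Proof.
  induction n as [|n IH]; simpl.
  - now rewrite sumto_zero.
  - now rewrite IH, sumto_plus.
Qed.

Lemma sumto_sum_f_R0 (f : nat -> nat -> R) (n m : nat) :
  sum_f_R0 (fun k => sumto (f k) n) m = sumto (fun i => sum_f_R0 (fun k => f k i) m) n.
Proof. induction m as [|m IH]; simpl; [easy|]. now rewrite IH, sumto_plus. Qed.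

Lemma sumto_extend (f : nat -> R) (n m : nat) :
  (n <= m)%nat -> (forall k, (n < k)%nat -> f k = 0) -> sumto f n = sumto f m.
Proof.
  intros Hnm H. induction Hnm as [|m Hnm IH]; [easy|].
  simpl. rewrite <- IH, H by lia. ring.
Qed.

Lemma sumto_S (f : nat -> R) (n : nat) : sumto f (S n) = sumto f n + f (S n).
Proof. reflexivity. Qed.

Lemma sumto_series (f : nat -> R) (n : nat) :
  sum_n (fun i => f (S i)) n = sumto f (S n).
Proof.
  induction n as [|n IH].
  - rewrite sum_O. simpl. ring.
  - rewrite sum_Sn, IH. reflexivity.
Qed.

Lemma sumto_alternating_bounds (f : nat -> R) (N : nat) :
  (forall k, (1 <= k)%nat -> 0 <= f (S k) <= f k) -> 0 <= f 1%nat ->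
  0 <= sumto (fun k => (-1) ^ S k * f k) N <= f 1%nat.
Proof.
  intros H H1.
  (* The even partial sums stay below [f 1] by at least [f (2n+1)], which is exactly the room needed
     to add the next, positive term when N is odd. *)
  assert (HH : forall n, 0 <= sumto (fun k => (-1) ^ S k * f k) (2 * n) <= f 1%nat - f (S (2 * n)) ).
  { induction n as [|n IH].
    - simpl. lra.
    - replace (2 * S n)%nat with (S (S (2 * n))) by lia. rewrite !sumto_S.
      replace ((-1) ^ S (S (2 * n))) with 1.
      2:{ rewrite <- !tech_pow_Rmult, pow_1_even. ring. }
      replace ((-1) ^ S (S (S (2 * n)))) with (-1).
      2:{ rewrite <- !tech_pow_Rmult, pow_1_even. ring. }
      pose proof (H (S (2 * n)) ltac:(lia)). pose proof (H (S (S (2 * n))) ltac:(lia)). lra. }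
  destruct (Nat.Even_or_Odd N) as [[n Hn]|[n Hn]]; subst N.
  - specialize (HH n). assert (0 <= f (S (2 * n))) by (destruct n; [easy|apply H; lia]). lra.
  - rewrite Nat.add_1_r, sumto_S.
    replace ((-1) ^ S (S (2 * n))) with 1.
    2:{ rewrite <- !tech_pow_Rmult, pow_1_even. ring. }
    specialize (HH n). assert (0 <= f (S (2 * n))) by (destruct n; [easy|apply H; lia]). lra.
Qed.

(** * Normalized binomial coefficients *)

Fixpoint cbin (n : nat) : R :=
  match n with
  | O => 1
  | S m => cbin m * ((2 * INR m + 1) / (2 * INR m + 2))
  end.

(* [ubin n k] is C(2n, n-k) / 4^n, and vanishes for [k > n]. *)
Fixpoint ubin (n k : nat) : R :=
  match k with
  | O => cbin n
  | S k' => ubin n k' * ((INR n - INR k') / (INR n + INR k' + 1))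
  end.

Definition acoef (n k : nat) : R := ubin n k * (INR n + INR k) / INR n ^ 2.

Lemma cbin_pos (n : nat) : 0 < cbin n.
Proof.
  induction n as [|n IH]; simpl; [lra|].
  pose proof (pos_INR n). apply Rmult_lt_0_compat; [easy|].
  apply Rdiv_lt_0_compat; lra.
Qed.

Lemma cbin_binomial (n : nat) : cbin n = Binomial.C (2 * n) n / 4 ^ n.
Proof.
  unfold Binomial.C. induction n as [|n IH].
  - simpl. field.
  - simpl cbin. rewrite IH.
    replace (2 * S n - S n)%nat with (S n) by lia.
    replace (2 * n - n)%nat with n by lia.
    replace (2 * S n)%nat with (S (S (2 * n))) by lia.
    rewrite !fact_simpl, !mult_INR, !S_INR, mult_INR.
    pose proof (INR_fact_neq_0 n). pose proof (pos_INR n). simpl (INR 2).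
    rewrite <- tech_pow_Rmult. assert (4 ^ n <> 0) by (apply pow_nonzero; lra).
    field. repeat split; try easy; lra.
Qed.

Lemma ubin_zero (n k : nat) : (n < k)%nat -> ubin n k = 0.
Proof.
  induction k as [|k IH]; intros H; [lia|]. simpl.
  destruct (Nat.eq_dec n k) as [->|Hn].
  - unfold Rdiv. ring.
  - rewrite IH by lia. ring.
Qed.

Lemma ubin_ge0 (n k : nat) : 0 <= ubin n k.
Proof.
  induction k as [|k IH].
  - left. apply cbin_pos.
  - destruct (Nat.le_gt_cases (S k) n) as [H|H].
    + simpl. apply Rmult_le_pos; [easy|]. pose proof (pos_INR n). pose proof (pos_INR k).
      apply le_INR in H. rewrite S_INR in H.
      apply Rdiv_le_0_compat; lra.
    + rewrite ubin_zero by lia. lra.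
Qed.

Lemma ubin_succ (n k : nat) :
  ubin n (S k) = ubin n k * ((INR n - INR k) / (INR n + INR k + 1)).
Proof. reflexivity. Qed.

Lemma ubin_S (n k : nat) :
  ubin n (S k) * (INR n + INR k + 1) = ubin n k * (INR n - INR k).
Proof. simpl. pose proof (pos_INR n). pose proof (pos_INR k). field. lra. Qed.

Lemma ubin_le (n k : nat) : ubin n k <= cbin n.
Proof.
  induction k as [|k IH]; [simpl; lra|]. apply Rle_trans with (2 := IH).
  pose proof (ubin_ge0 n k). pose proof (ubin_S n k).
  pose proof (pos_INR n). pose proof (pos_INR k).
  apply Rmult_le_reg_r with (INR n + INR k + 1); [lra|]. rewrite H0. nra.
Qed.

(** The ratio of C(2n+2,n+1-k)/4^(n+1) to C(2n,n-k)/4^n, cross-multiplied because the factor n+1-k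
    vanishes at k = n+1. The induction on k moves both rows from k to k+1 by [ubin_S]. *)
Lemma ubin_Sn (n k : nat) :
  ubin (S n) k * ((INR n + 1 - INR k) * (INR n + 1 + INR k))
  = ubin n k * ((INR n + 1) * (2 * INR n + 1) / 2).
Proof.
  pose proof (pos_INR n).
  induction k as [|k IH].
  - simpl. field. lra.
  - pose proof (ubin_S n k). pose proof (ubin_S (S n) k). pose proof (pos_INR k).
    rewrite !S_INR in *.
    apply Rmult_eq_reg_r with (INR n + INR k + 1); [|lra].
    replace (ubin n (S k) * ((INR n + 1) * (2 * INR n + 1) / 2) * (INR n + INR k + 1))
      with (ubin n (S k) * (INR n + INR k + 1) * ((INR n + 1) * (2 * INR n + 1) / 2)) by ring.
    rewrite H0.
    replace (ubin n k * (INR n - INR k) * ((INR n + 1) * (2 * INR n + 1) / 2))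
      with (ubin n k * ((INR n + 1) * (2 * INR n + 1) / 2) * (INR n - INR k)) by ring.
    rewrite <- IH.
    replace (ubin (S n) (S k) * ((INR n + 1 - (INR k + 1)) * (INR n + 1 + (INR k + 1))) * (INR n + INR k + 1))
      with (ubin (S n) (S k) * (INR n + 1 + INR k + 1) * ((INR n - INR k) * (INR n + INR k + 1))) by ring.
    rewrite H1. ring.
Qed.

(** A crude form of the decay of c_n like n^(-1/2), enough for c_n to tend to 0; squaring keeps the
    induction rational. *)
Lemma cbin_sqr_le (n : nat) : cbin n ^ 2 <= / (INR n + 1).
Proof.
  induction n as [|n IH]; [simpl; lra|].
  pose proof (pos_INR n). simpl cbin. rewrite Rpow_mult_distr, S_INR.
  apply Rle_trans with (/ (INR n + 1) * ((2 * INR n + 1) / (2 * INR n + 2)) ^ 2).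
  - apply Rmult_le_compat_r; [apply pow2_ge_0|easy].
  - apply Rminus_le_0.
    replace (_ - _) with ((3 * INR n + 2) / (4 * (INR n + 1) ^ 3 * (INR n + 2)))
      by (field; lra).
    apply Rdiv_le_0_compat; [lra|].
    apply Rmult_lt_0_compat; [|lra]. apply Rmult_lt_0_compat; [lra|]. apply pow_lt; lra.
Qed.

Lemma cbin_lim : is_lim_seq cbin 0.
Proof.
  apply is_lim_seq_le_le with (u := fun _ => 0) (w := fun n => sqrt (/ (INR n + 1))).
  - intros n. split; [left; apply cbin_pos|].
    rewrite <- (sqrt_pow2 (cbin n)) by (left; apply cbin_pos).
    apply sqrt_le_1_alt, cbin_sqr_le.
  - apply is_lim_seq_const.
  - rewrite <- sqrt_0.
    apply (is_lim_seq_continuous sqrt (fun n => / (INR n + 1)) 0).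
    + apply continuity_pt_sqrt. lra.
    + apply is_lim_seq_inv with (l := p_infty); [|easy].
      apply is_lim_seq_ext with (fun n => INR (S n)); [intros; apply S_INR|].
      apply -> is_lim_seq_incr_1. apply is_lim_seq_INR.
Qed.

Lemma ubin_lim (k : nat) : is_lim_seq (fun n => ubin n k) 0.
Proof.
  apply is_lim_seq_le_le with (u := fun _ => 0) (w := cbin).
  - intros n. split; [apply ubin_ge0|apply ubin_le].
  - apply is_lim_seq_const.
  - apply cbin_lim.
Qed.

(** * Hitting probabilities of the simple random walk *)

(* k/n C(2n,n-k)/4^n is the probability that the simple random walk first hits 2k at time 2n. *)
Lemma hitting_telescope (N k : nat) :
  sumto (fun n => INR k * ubin n k / INR n) N
  - sumto (fun n => INR (S k) * ubin n (S k) / INR n) N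
  = ubin N k + ubin N (S k) - (ubin 0 k + ubin 0 (S k)).
Proof.
  induction N as [|n IH]; [simpl sumto; ring|].
  rewrite !sumto_S.
  enough (INR k * ubin (S n) k / INR (S n) - INR (S k) * ubin (S n) (S k) / INR (S n)
    = ubin (S n) k + ubin (S n) (S k) - (ubin n k + ubin n (S k))) by lra.
  (* Row n is expressed through row n+1, and not conversely: this divides by (n+1)(2n+1)/2, which
     never vanishes, instead of by n+1-k. *)
  assert (Hn : ubin n k = ubin (S n) k * ((INR n + 1 - INR k) * (INR n + 1 + INR k))
                   / ((INR n + 1) * (2 * INR n + 1) / 2)).
  { rewrite ubin_Sn. pose proof (pos_INR n). field. split; lra. }
  rewrite !ubin_succ, Hn, !S_INR.
  pose proof (pos_INR n). pose proof (pos_INR k). field. repeat split; lra.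
Qed.

(** At k = 0 the first sum of the telescoping identity vanishes and the boundary term [ubin 0 0]
    supplies the 1. For larger k the boundary terms are 0, so consecutive columns have the same
    limit. *)
Lemma hitting_lim (k : nat) :
  is_lim_seq (sumto (fun n => INR (S k) * ubin n (S k) / INR n)) 1.
Proof.
  assert (HT : forall m, is_lim_seq (fun N => ubin N m + ubin N (S m)) 0).
  { intros m. replace (Finite 0) with (Finite (0 + 0)) by (f_equal; ring).
    apply is_lim_seq_plus'; apply ubin_lim. }
  induction k as [|k IH].
  - apply is_lim_seq_ext with (fun N => 1 - (ubin N 0 + ubin N 1)).
    + intros N. pose proof (hitting_telescope N 0) as H.
      rewrite (sumto_ext (fun n => INR 0 * ubin n 0 / INR n) (fun _ => 0)) in H
        by (intros; unfold Rdiv; simpl; ring).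
      rewrite sumto_zero in H. rewrite (ubin_zero 0 1) in H by lia.
      change (ubin 0 0) with 1 in H. lra.
    + replace (Finite 1) with (Finite (1 - 0)) by (f_equal; ring).
      apply is_lim_seq_minus'; [apply is_lim_seq_const|apply HT].
  - apply is_lim_seq_ext with (fun N => sumto (fun n => INR (S k) * ubin n (S k) / INR n) N
       - (ubin N (S k) + ubin N (S (S k)))).
    + intros N. pose proof (hitting_telescope N (S k)) as H.
      rewrite (ubin_zero 0 (S k)), (ubin_zero 0 (S (S k))) in H by lia. lra.
    + replace (Finite 1) with (Finite (1 - 0)) by (f_equal; ring).
      apply is_lim_seq_minus'; [apply IH|apply HT].
Qed.

(** * The coefficients a(n,k) and their column sums S_k *)

Lemma acoef_zero (n k : nat) : (n < k)%nat -> acoef n k = 0.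
Proof. intros H. unfold acoef. rewrite ubin_zero by easy. unfold Rdiv. ring. Qed.

Lemma acoef_ge0 (n k : nat) : (1 <= n)%nat -> 0 <= acoef n k.
Proof.
  intros H. apply le_INR in H. simpl in H. unfold acoef. apply Rdiv_le_0_compat.
  - apply Rmult_le_pos; [apply ubin_ge0|]. pose proof (pos_INR k). lra.
  - apply pow_lt. lra.
Qed.

(** With this form a(n,k) and a(n,k+1) share the factor u(n,k)/n^2, multiplied by n+k and n-k
    respectively. Comparing the two gives monotonicity in k; adding them gives 2 u(n,k)/n. *)
Lemma acoef_S (n k : nat) : acoef n (S k) = ubin n k * (INR n - INR k) / INR n ^ 2.
Proof. unfold acoef. rewrite <- ubin_S, S_INR. f_equal. ring. Qed.

Lemma acoef_decr (n k : nat) : (1 <= n)%nat -> acoef n (S k) <= acoef n k.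
Proof.
  intros H. rewrite acoef_S. unfold acoef, Rdiv. apply le_INR in H. simpl in H.
  apply Rmult_le_compat_r.
  - left. apply Rinv_0_lt_compat, pow_lt. lra.
  - apply Rmult_le_compat_l; [apply ubin_ge0|]. pose proof (pos_INR k). lra.
Qed.

Lemma acoef_pair (n k : nat) : (1 <= n)%nat ->
  acoef n k + acoef n (S k) = 2 * (ubin n k / INR n).
Proof.
  intros H. rewrite acoef_S. unfold acoef. apply le_INR in H. simpl in H.
  field. lra.
Qed.

Lemma acoef_pair_lim (k : nat) : (1 <= k)%nat ->
  is_lim_seq (fun N => sumto (fun n => acoef n k) N + sumto (fun n => acoef n (S k)) N)
    (2 / INR k).
Proof.
  intros Hk. destruct k as [|k]; [lia|].
  pose proof (pos_INR k) as Hk0.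
  apply is_lim_seq_ext with
    (fun N => 2 / INR (S k) * sumto (fun n => INR (S k) * ubin n (S k) / INR n) N).
  - intros N. rewrite <- sumto_plus, <- sumto_scal. apply sumto_ext.
    intros n [Hn _]. rewrite acoef_pair by easy. apply le_INR in Hn. simpl (INR 1) in Hn.
    rewrite !S_INR. field. lra.
  - replace (Finite (2 / INR (S k))) with (Rbar_mult (2 / INR (S k)) 1)
      by (simpl; f_equal; ring).
    apply is_lim_seq_scal_l, hitting_lim.
Qed.

Lemma sumto_incr (f : nat -> R) (n : nat) :
  (forall k, (1 <= k)%nat -> 0 <= f k) -> sumto f n <= sumto f (S n).
Proof. intros H. simpl. specialize (H (S n) ltac:(lia)). lra. Qed.

Definition acol (k : nat) : R := real (Lim_seq (sumto (fun n => acoef n k))).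

(** The partial sums increase, and adding the nonnegative column k+1 shows that they are bounded by
    2/k. *)
Lemma acol_lim (k : nat) : (1 <= k)%nat ->
  is_lim_seq (sumto (fun n => acoef n k)) (acol k).
Proof.
  intros Hk. apply Lim_seq_correct'.
  apply ex_finite_lim_seq_incr with (2 / INR k).
  - intros n. apply sumto_incr. intros; now apply acoef_ge0.
  - intros n.
    apply Rle_trans with (sumto (fun n => acoef n k) n + sumto (fun n => acoef n (S k)) n).
    + assert (0 <= sumto (fun n => acoef n (S k)) n); [|lra].
      induction n as [|n IH]; simpl; [lra|].
      pose proof (acoef_ge0 (S n) (S k) ltac:(lia)). lra.
    + apply (is_lim_seq_incr_compare _ _ (acoef_pair_lim k Hk)).
      intros m. apply Rplus_le_compat; apply sumto_incr; intros; now apply acoef_ge0.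
Qed.

Lemma acol_pair (k : nat) : (1 <= k)%nat -> acol k + acol (S k) = 2 / INR k.
Proof.
  intros Hk.
  pose proof (is_lim_seq_unique _ _ (acoef_pair_lim k Hk)) as H.
  pose proof (is_lim_seq_unique _ _
    (is_lim_seq_plus' _ _ _ _ (acol_lim k Hk) (acol_lim (S k) ltac:(lia)))) as H'.
  rewrite H in H'. now injection H'.
Qed.

Lemma acol_tail_ge0 (k N : nat) : (1 <= k)%nat ->
  0 <= acol k - sumto (fun n => acoef n k) N.
Proof.
  intros Hk.
  pose proof (is_lim_seq_incr_compare _ _ (acol_lim k Hk)
    ltac:(intros; apply sumto_incr; intros; now apply acoef_ge0) N). lra.
Qed.

(** The differences a(n,k) - a(n,k+1) are nonnegative, so their partial sums do not exceed S_k -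
    S_{k+1}. Decreasing tails are what the alternating bound requires of the truncation error. *)
Lemma acol_tail_decr (k N : nat) : (1 <= k)%nat ->
  acol (S k) - sumto (fun n => acoef n (S k)) N <= acol k - sumto (fun n => acoef n k) N.
Proof.
  intros Hk.
  assert (H : is_lim_seq (sumto (fun n => acoef n k - acoef n (S k))) (acol k - acol (S k))).
  { apply is_lim_seq_ext with
      (fun N => sumto (fun n => acoef n k) N - sumto (fun n => acoef n (S k)) N).
    - intros. now rewrite sumto_minus.
    - apply is_lim_seq_minus'; apply acol_lim; lia. }
  assert (H' : sumto (fun n => acoef n k - acoef n (S k)) N <= acol k - acol (S k)).
  { apply (is_lim_seq_incr_compare _ _ H).
    intros M. apply sumto_incr. intros n Hn. pose proof (acoef_decr n k Hn). lra. }
  rewrite sumto_minus in H'. lra.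
Qed.

Lemma acol_ge0 (k : nat) : (1 <= k)%nat -> 0 <= acol k.
Proof. intros Hk. pose proof (acol_tail_ge0 k 0 Hk). simpl in *. lra. Qed.

Lemma acol_decr (k : nat) : (1 <= k)%nat -> acol (S k) <= acol k.
Proof. intros Hk. pose proof (acol_tail_decr k 0 Hk). simpl in *. lra. Qed.

Lemma acol_lim0 : is_lim_seq (fun N => acol (S N)) 0.
Proof.
  apply is_lim_seq_le_le with (u := fun _ => 0) (w := fun N => 2 * / INR (S N)).
  - intros n. split; [apply acol_ge0; lia|].
    pose proof (acol_pair (S n) ltac:(lia)). pose proof (acol_ge0 (S (S n)) ltac:(lia)).
    unfold Rdiv in *. lra.
  - apply is_lim_seq_const.
  - replace (Finite 0) with (Rbar_mult 2 0) by (simpl; f_equal; ring).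
    apply is_lim_seq_scal_l.
    apply is_lim_seq_inv with (l := p_infty); [|easy].
    apply -> is_lim_seq_incr_1. apply is_lim_seq_INR.
Qed.

(** Each 1/(m+l-1) is half of S_{m+l-1} + S_{m+l}, so the alternating sum telescopes and only its
    two ends survive. *)
Lemma acol_alternating (m L : nat) : (1 <= m)%nat ->
  sumto (fun l => (-1) ^ S l / (INR m + INR l - 1)) L
  = (acol m - (-1) ^ L * acol (m + L)) / 2.
Proof.
  intros Hm. induction L as [|L IH].
  - simpl. rewrite Nat.add_0_r. field.
  - rewrite sumto_S, IH. pose proof (acol_pair (m + L) ltac:(lia)) as H.
    replace (m + S L)%nat with (S (m + L)) by lia.
    replace (acol (S (m + L))) with (2 / INR (m + L) - acol (m + L)) by lra.
    apply le_INR in Hm. simpl in Hm. pose proof (pos_INR L).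
    rewrite plus_INR, S_INR, <- !tech_pow_Rmult. field. lra.
Qed.

(** * Partial fractions of the generating function of the star sums *)

(* [gcoef n k * (2k-1)^2] is the coefficient of [1 / ((2k-1)^2 - x^2)] in the
   partial fractions of the product of [1 / (1 - x^2/(2i-1)^2)] over [1 <= i <= n]. *)
Definition gcoef (n k : nat) : R :=
  4 * (-1) ^ S k * cbin n * ubin n k * (INR n + INR k) / (2 * INR k - 1).

(** Removing the factor i = n+1 from the product multiplies it by 1 - x^2/(2n+1)^2, hence multiplies
    the coefficient at the pole x = 2k-1 by the value of this factor there. *)
Lemma gcoef_step (n k : nat) : (1 <= k)%nat ->
  gcoef n k = gcoef (S n) k * (1 - (2 * INR k - 1) ^ 2 / (2 * INR n + 1) ^ 2).
Proof.
  intros Hk. apply le_INR in Hk. simpl in Hk. pose proof (pos_INR n).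
  unfold gcoef.
  assert (Hn : ubin n k = ubin (S n) k * ((INR n + 1 - INR k) * (INR n + 1 + INR k))
                   / ((INR n + 1) * (2 * INR n + 1) / 2)).
  { rewrite ubin_Sn. field. split; lra. }
  rewrite Hn. simpl cbin. rewrite S_INR. field. repeat split; lra.
Qed.

Lemma gcoef_zero (n k : nat) : (n < k)%nat -> gcoef n k = 0.
Proof. intros H. unfold gcoef. rewrite ubin_zero by easy. unfold Rdiv. ring. Qed.

(** For n >= 2 the full sum must vanish, since the product decays faster than x^(-2) at infinity.
    The closed form of the partial sums proves it through the factor n-K; the factor n-1 accounts
    for n = 1, where the sum is 1. *)
Lemma gcoef_sqr_telescope (n K : nat) :
  (INR n - 1) * sumto (fun k => gcoef n k * (2 * INR k - 1) ^ 2) K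
  = 4 * cbin n * ((-1) ^ S K * INR K * (INR n - INR K) * (INR n + INR K) * ubin n K).
Proof.
  induction K as [|K IH].
  - simpl. ring.
  - rewrite sumto_S, Rmult_plus_distr_l, IH. unfold gcoef.
    pose proof (pos_INR K). pose proof (pos_INR n).
    rewrite ubin_succ, S_INR, <- !tech_pow_Rmult. field. split; lra.
Qed.

(** This is the partial fraction expansion at x = 0. By [gcoef_step], passing from n+1 to n changes
    the sum by a multiple of the sum that [gcoef_sqr_telescope] makes zero. *)
Lemma gcoef_sum (n : nat) : (1 <= n)%nat -> sumto (gcoef n) n = 1.
Proof.
  intros Hn. induction Hn as [|n Hn IH].
  - unfold gcoef. simpl. field.
  - assert (Hz : sumto (fun k => gcoef (S n) k * (2 * INR k - 1) ^ 2) (S n) = 0).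
    { apply Rmult_eq_reg_l with (INR (S n) - 1).
      - rewrite gcoef_sqr_telescope. ring.
      - apply le_INR in Hn. simpl in Hn. rewrite S_INR. lra. }
    rewrite <- IH.
    rewrite (sumto_extend (gcoef n) n (S n)) by (try lia; intros; now apply gcoef_zero).
    rewrite (sumto_ext (gcoef n) (fun k => gcoef (S n) k
       - / (2 * INR n + 1) ^ 2 * (gcoef (S n) k * (2 * INR k - 1) ^ 2)) (S n)).
    + rewrite sumto_minus, sumto_scal, Hz. ring.
    + intros k [Hk _]. rewrite gcoef_step by easy. unfold Rdiv. ring.
Qed.

(** The right side is the coefficient of x^(2j) in the expanded partial fractions. The proof checks
    the recursion in n instead: divided by (2k-1)^(2j+2), [gcoef_step] is the increment of the k-th
    term. *)
Lemma tstar2_partial_fractions (j n : nat) : (1 <= n)%nat ->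
  tstar2 j n = sumto (fun k => gcoef n k / (2 * INR k - 1) ^ (2 * j)) n.
Proof.
  revert n. induction j as [|j IH]; intros n Hn.
  - simpl tstar2. rewrite <- (gcoef_sum n Hn). apply sumto_ext. intros. simpl. field.
  (* At positive depth both sides are empty sums for n = 0, so the inner induction may start
     there. *)
  - clear Hn. simpl tstar2. induction n as [|n IHn]; [easy|].
    rewrite sumto_S, IHn, (IH (S n)) by lia.
    rewrite (sumto_extend _ n (S n)).
    2: lia.
    2: { intros k Hk. rewrite gcoef_zero by easy. unfold Rdiv. ring. }
    unfold Rdiv at 2. rewrite Rmult_comm, <- sumto_scal, <- sumto_plus.
    apply sumto_ext. intros k [Hk _]. rewrite (gcoef_step n k Hk).
    apply le_INR in Hk. simpl in Hk. pose proof (pos_INR n).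
    replace (2 * S j)%nat with (2 * j + 2)%nat by lia. rewrite pow_add, S_INR.
    assert ((2 * INR k - 1) ^ (2 * j) <> 0) by (apply pow_nonzero; lra).
    field. repeat split; try easy; lra.
Qed.

Definition ecoef (j k : nat) : R := (-1) ^ S k * (/ (2 * INR k - 1)) ^ (2 * j + 1).

(** The factor c_n inside [gcoef] cancels the central binomial coefficient of the denominator. *)
Lemma term_expansion (j n : nat) : (1 <= n)%nat ->
  4 ^ n / (INR n ^ 2 * Binomial.C (2 * n) n) * tstar2 j n
  = sumto (fun k => 4 * ecoef j k * acoef n k) n.
Proof.
  intros Hn. rewrite tstar2_partial_fractions by easy. rewrite <- sumto_scal.
  apply sumto_ext. intros k [Hk _]. unfold gcoef, ecoef, acoef.
  apply le_INR in Hk, Hn. simpl in Hk, Hn.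
  pose proof (cbin_binomial n) as Hc. pose proof (cbin_pos n) as Hp.
  assert (H4 : 4 ^ n <> 0) by (apply pow_nonzero; lra).
  assert (HC : Binomial.C (2 * n) n = cbin n * 4 ^ n) by (rewrite Hc; now field).
  rewrite HC, pow_add, pow_inv, pow_1.
  assert ((2 * INR k - 1) ^ (2 * j) <> 0) by (apply pow_nonzero; lra).
  field. repeat split; try easy; lra.
Qed.

Lemma partial_sum_expansion (j N : nat) :
  sumto (fun n => 4 ^ n / (INR n ^ 2 * Binomial.C (2 * n) n) * tstar2 j n) N
  = 4 * sumto (fun k => ecoef j k * sumto (fun n => acoef n k) N) N.
Proof.
  (* The inner range grows from n to N at no cost, as a(n,k) = 0 for k > n; the square double sum
     can then be swapped. *)
  rewrite (sumto_ext _ (fun n => sumto (fun k => 4 * ecoef j k * acoef n k) N)).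
  - rewrite sumto_swap, <- sumto_scal. apply sumto_ext. intros k _.
    rewrite sumto_scal. ring.
  - intros n [Hn HN]. rewrite term_expansion by easy.
    apply sumto_extend; [easy|]. intros k Hk. rewrite acoef_zero by easy. ring.
Qed.

(** * Truncated beta values and their alternating convolution *)

Definition beta_partial (N m : nat) : R :=
  sumto (fun l => (-1) ^ S l * (/ (2 * INR l - 1)) ^ m) N.

Lemma beta_partial_lim (m : nat) : (1 <= m)%nat ->
  is_lim_seq (fun N => beta_partial N m) (dbeta m).
Proof.
  intros Hm. pose (U := fun k : nat => / (2 * INR k + 1) ^ m).
  destruct (alternated_series U) as [l Hl].
  - intros k. unfold U. pose proof (pos_INR k). rewrite S_INR.
    apply Rinv_le_contravar; [apply pow_lt; lra|]. apply pow_incr. lra.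
  - apply is_lim_seq_Reals.
    apply is_lim_seq_le_le with (u := fun _ => 0) (w := fun k => / INR (S k)).
    + intros k. unfold U. pose proof (pos_INR k). rewrite S_INR. split.
      * left. apply Rinv_0_lt_compat, pow_lt. lra.
      * apply Rinv_le_contravar; [lra|].
        apply Rle_trans with ((2 * INR k + 1) ^ 1); [simpl; lra|].
        apply Rle_pow; [lra|easy].
    + apply is_lim_seq_const.
    + apply is_lim_seq_inv with (l := p_infty); [|easy].
      apply -> is_lim_seq_incr_1. apply is_lim_seq_INR.
  - assert (Hs : is_series (fun k : nat => (-1) ^ k / (2 * INR k + 1) ^ m) l).
    { apply is_series_Reals. intros eps Heps. destruct (Hl eps Heps) as [N HN].
      exists N. intros n Hn. exact (HN n Hn). }
    unfold dbeta. rewrite (is_series_unique _ _ Hs).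
    (* The partial sum of the series up to index N has N+1 terms. *)
    apply is_lim_seq_incr_1.
    apply is_lim_seq_ext with (2 := Hs).
    intros N. unfold beta_partial. rewrite <- sumto_series. apply sum_n_ext.
    assert (HU : forall k, (-1) ^ k / (2 * INR k + 1) ^ m
                    = (-1) ^ S (S k) * (/ (2 * INR (S k) - 1)) ^ m).
    { intros k. rewrite pow_inv, S_INR, <- !tech_pow_Rmult.
      replace (2 * (INR k + 1) - 1) with (2 * INR k + 1) by ring.
      unfold Rdiv. ring. }
    exact HU.
Qed.

Lemma alternating_geometric (a b : R) (n : nat) :
  (a + b) * sum_f_R0 (fun k => (-1) ^ k * a ^ k * b ^ (n - k)) n
  = b ^ S n + (-1) ^ n * a ^ S n.
Proof.
  induction n as [|n IH].
  - simpl. ring.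
  - rewrite tech5.
    rewrite (sum_eq _ (fun k => ((-1) ^ k * a ^ k * b ^ (n - k)) * b)).
    + rewrite <- scal_sum, Nat.sub_diag, Rmult_plus_distr_l.
      replace ((a + b) * (b * sum_f_R0 (fun k => (-1) ^ k * a ^ k * b ^ (n - k)) n))
        with (b * ((a + b) * sum_f_R0 (fun k => (-1) ^ k * a ^ k * b ^ (n - k)) n)) by ring.
      rewrite IH. simpl. ring.
    + intros k Hk. replace (S n - k)%nat with (S (n - k)) by lia. simpl. ring.
Qed.

Definition beta_conv (j N : nat) : R :=
  sum_f_R0 (fun k => (-1) ^ k * beta_partial N (k + 1) * beta_partial N (2 * j - k + 1)) (2 * j).

(** With a = 1/(2m-1) and b = 1/(2l-1), the geometric sum is (a^(2j+1) + b^(2j+1))/(a+b), the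
    exponent 2j being even, and ab/(a+b) = 1/(2(m+l-1)). Each of the two powers yields one of the
    symmetric terms. *)
Lemma beta_conv_kernel (j m l : nat) : (1 <= m)%nat -> (1 <= l)%nat ->
  sum_f_R0 (fun k => (-1) ^ k * ((-1) ^ S m * (/ (2 * INR m - 1)) ^ (k + 1))
                     * ((-1) ^ S l * (/ (2 * INR l - 1)) ^ (2 * j - k + 1))) (2 * j)
  = ecoef j m * ((-1) ^ S l / (INR m + INR l - 1)) / 2
    + ecoef j l * ((-1) ^ S m / (INR l + INR m - 1)) / 2.
Proof.
  intros Hm Hl. apply le_INR in Hm, Hl. simpl in Hm, Hl.
  set (a := / (2 * INR m - 1)). set (b := / (2 * INR l - 1)).
  assert (Ha : 0 < a) by (apply Rinv_0_lt_compat; lra).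
  assert (Hb : 0 < b) by (apply Rinv_0_lt_compat; lra).
  rewrite (sum_eq _ (fun k => ((-1) ^ k * a ^ k * b ^ (2 * j - k))
                               * ((-1) ^ S m * (-1) ^ S l * a * b))).
  2:{ intros k _. rewrite !pow_add, !pow_1. ring. }
  rewrite <- scal_sum.
  pose proof (alternating_geometric a b (2 * j)) as H.
  rewrite pow_1_even in H.
  apply Rmult_eq_reg_l with (a + b); [|lra].
  rewrite <- Rmult_assoc, (Rmult_comm (a + b)), Rmult_assoc, H.
  unfold ecoef. fold a b. rewrite !Nat.add_1_r.
  assert (Hk : a + b = 2 * (INR m + INR l - 1) * (a * b)) by (unfold a, b; field; lra).
  rewrite Hk. field. lra.
Qed.

Lemma beta_conv_expansion (j N : nat) :
  beta_conv j N = sumto (fun m => ecoef j m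
     * sumto (fun l => (-1) ^ S l / (INR m + INR l - 1)) N) N.
Proof.
  unfold beta_conv, beta_partial.
  rewrite (sum_eq _ (fun k => sumto (fun m => sumto (fun l =>
      (-1) ^ k * ((-1) ^ S m * (/ (2 * INR m - 1)) ^ (k + 1))
       * ((-1) ^ S l * (/ (2 * INR l - 1)) ^ (2 * j - k + 1))) N) N)).
  2:{ intros k _. rewrite Rmult_assoc, (Rmult_comm (sumto _ _)), <- Rmult_assoc, <- sumto_scal.
      apply sumto_ext. intros m _. rewrite sumto_scal. ring. }
  rewrite sumto_sum_f_R0.
  rewrite (sumto_ext _ (fun m =>
     sumto (fun l => ecoef j m * ((-1) ^ S l / (INR m + INR l - 1)) / 2) N
   + sumto (fun l => ecoef j l * ((-1) ^ S m / (INR l + INR m - 1)) / 2) N)).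
  2:{ intros m [Hm _]. rewrite sumto_sum_f_R0, <- sumto_plus. apply sumto_ext.
      intros l [Hl _]. now apply beta_conv_kernel. }
  rewrite sumto_plus.
  (* Exchanging m and l turns the second half into the first, which absorbs the factors 1/2. *)
  rewrite (sumto_swap (fun m l => ecoef j l * ((-1) ^ S m / (INR l + INR m - 1)) / 2)).
  rewrite <- sumto_plus. apply sumto_ext. intros m _.
  rewrite <- sumto_plus, <- sumto_scal. apply sumto_ext. intros l _.
  generalize ((-1) ^ S l / (INR m + INR l - 1)). intros x. field.
Qed.

Lemma beta_conv_lim (j : nat) :
  is_lim_seq (beta_conv j)
    (sum_f_R0 (fun k => (-1) ^ k * dbeta (k + 1) * dbeta (2 * j - k + 1)) (2 * j)).
Proof.
  unfold beta_conv.
  (* Only the upper limit is generalized to p; the 2j in the index stays fixed, so that induction on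
     p applies. *)
  enough (H : forall p, is_lim_seq
    (fun N => sum_f_R0 (fun k => (-1) ^ k * beta_partial N (k + 1)
                                 * beta_partial N (2 * j - k + 1)) p)
    (sum_f_R0 (fun k => (-1) ^ k * dbeta (k + 1) * dbeta (2 * j - k + 1)) p)) by apply H.
  induction p as [|p IH]; simpl sum_f_R0.
  - apply is_lim_seq_mult'; [apply is_lim_seq_mult'|]; [apply is_lim_seq_const| |];
      apply beta_partial_lim; lia.
  - apply is_lim_seq_plus'; [exact IH|].
    apply is_lim_seq_mult'; [apply is_lim_seq_mult'|]; [apply is_lim_seq_const| |];
      apply beta_partial_lim; lia.
Qed.

(** * Error estimate and conclusion *)

(** The weights (2k-1)^(-(2j+1)) are positive, decreasing and equal to 1 at k = 1, so the products
    with [f] still decrease and the first one is [f 1]. *)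
Lemma ecoef_alternating_bounds (j N : nat) (f : nat -> R) :
  (forall k, (1 <= k)%nat -> 0 <= f k) -> (forall k, (1 <= k)%nat -> f (S k) <= f k) ->
  0 <= sumto (fun k => ecoef j k * f k) N <= f 1%nat.
Proof.
  intros Hp Hd.
  rewrite (sumto_ext _ (fun k => (-1) ^ S k * ((/ (2 * INR k - 1)) ^ (2 * j + 1) * f k)))
    by (intros; unfold ecoef; ring).
  replace (f 1%nat) with ((/ (2 * INR 1 - 1)) ^ (2 * j + 1) * f 1%nat).
  2:{ replace (/ (2 * INR 1 - 1)) with 1 by (simpl; field). rewrite pow1. ring. }
  assert (Hx : forall k, (1 <= k)%nat -> 0 < / (2 * INR k - 1)).
  { intros k Hk. apply le_INR in Hk. simpl in Hk. apply Rinv_0_lt_compat. lra. }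
  apply (sumto_alternating_bounds (fun k => (/ (2 * INR k - 1)) ^ (2 * j + 1) * f k)).
  - intros k Hk. pose proof (Hx k Hk). pose proof (Hx (S k) ltac:(lia)). split.
    + apply Rmult_le_pos; [apply pow_le; lra|apply Hp; lia].
    + apply Rmult_le_compat; [apply pow_le; lra|apply Hp; lia| |now apply Hd].
      apply pow_incr. split; [lra|]. apply le_INR in Hk. simpl in Hk.
      apply Rinv_le_contravar; [lra|]. rewrite S_INR. lra.
  - apply Rmult_le_pos; [|now apply Hp]. apply pow_le. left. now apply Hx.
Qed.

Lemma partial_sum_error (j N : nat) :
  Rabs (sumto (fun n => 4 ^ n / (INR n ^ 2 * Binomial.C (2 * n) n) * tstar2 j n) N
        - 8 * beta_conv j N)
  <= 4 * (acol 1 - sumto (fun n => acoef n 1) N) + 4 * acol (S N).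
Proof.
  pose proof (ecoef_alternating_bounds j N
    (fun k => acol k - sumto (fun n => acoef n k) N)
    (fun k Hk => acol_tail_ge0 k N Hk) (fun k Hk => acol_tail_decr k N Hk)) as HA.
  pose proof (ecoef_alternating_bounds j N (fun k => acol (k + N))
    (fun k Hk => acol_ge0 (k + N) ltac:(lia)) (fun k Hk => acol_decr (k + N) ltac:(lia))) as HB.
  cbv beta in HA, HB. change (1 + N)%nat with (S N) in HB.
  rewrite partial_sum_expansion, beta_conv_expansion.
  rewrite (sumto_ext (fun m => ecoef j m
      * sumto (fun l => (-1) ^ S l / (INR m + INR l - 1)) N)
    (fun m => / 2 * (ecoef j m * (acol m - sumto (fun n => acoef n m) N))
            + / 2 * (ecoef j m * sumto (fun n => acoef n m) N)
            - (-1) ^ N / 2 * (ecoef j m * acol (m + N)))).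
  2:{ intros m [Hm _]. rewrite acol_alternating by easy. field. }
  rewrite sumto_minus, sumto_plus, !sumto_scal.
  (* X carries the column tails, Y the shifted columns S_{m+N}, and Z the truncated columns. The
     partial sum is 4Z and 8 [beta_conv j N] is 4X + 4Z - 4(-1)^N Y, so Z cancels. *)
  set (X := sumto _ N) in HA |- *. set (Y := sumto _ N) in HB |- *.
  set (Z := sumto (fun k => ecoef j k * sumto _ N) N).
  replace (4 * Z - _) with (- (4 * X) + 4 * ((-1) ^ N * Y)) by field.
  apply Rle_trans with (1 := Rabs_triang _ _).
  rewrite Rabs_Ropp, !Rabs_mult, pow_1_abs, !Rabs_pos_eq by lra. lra.
Qed.

Theorem theorem1 (j : nat) :
  is_series
    (fun i : nat =>
       4 ^ (S i) / (INR (S i) ^ 2 * Binomial.C (2 * S i) (S i)) * tstar2 j (S i))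
    (8 * sum_f_R0
           (fun k : nat => (-1) ^ k * dbeta (k + 1) * dbeta (2 * j - k + 1))
           (2 * j)).
Proof.
  set (P := fun n => 4 ^ n / (INR n ^ 2 * Binomial.C (2 * n) n) * tstar2 j n).
  set (L := sum_f_R0 _ _).
  enough (HP : is_lim_seq (sumto P) (8 * L)).
  (* Index i of the series stands for n = i+1, so its partial sum up to N is [sumto P (S N)]. *)
  { apply is_lim_seq_incr_1 in HP. apply is_lim_seq_ext with (2 := HP).
    intros N. symmetry. apply (sumto_series P). }
  apply is_lim_seq_ext with (fun N => (sumto P N - 8 * beta_conv j N) + 8 * beta_conv j N).
  { intros N. ring. }
  replace (8 * L) with (0 + 8 * L) by ring.
  apply is_lim_seq_plus'.
  - apply is_lim_seq_abs_0.
    apply is_lim_seq_le_le with (u := fun _ => 0)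
      (w := fun N => 4 * (acol 1 - sumto (fun n => acoef n 1) N) + 4 * acol (S N)).
    + intros N. split; [apply Rabs_pos|apply partial_sum_error].
    + apply is_lim_seq_const.
    + replace (Finite 0) with (Finite (4 * (acol 1 - acol 1) + 4 * 0)) by (f_equal; ring).
      apply is_lim_seq_plus'; apply is_lim_seq_mult'; try apply is_lim_seq_const.
      * apply is_lim_seq_minus'; [apply is_lim_seq_const|now apply acol_lim].
      * apply acol_lim0.
  - apply is_lim_seq_mult'; [apply is_lim_seq_const|apply beta_conv_lim].
Qed.
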